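(* Let $c$ be a closed, unit-speed curve of length $2\pi$ in $\mathbf{R}^n$. For $0<s<2\pi$, if $f\colon\mathbf{R}\to\mathbf{R}$ is increasing and concave on $(0,d(0,s)^2]$, where $d(s,t)$ is the shortest distance along the curve between $c(s)$ and $c(t)$, then $$\frac{1}{2\pi}\int f\left(|c(t+s)-c(t)|^2\right)\,dt\;\le\; f\left(\lambda^2(s)\right),$$ and equality holds if and only if $c$ is the unit circle.
   Context: A closed, unit-speed curve of length $2\pi$ in $\mathbf{R}^n$ is a curve $c\colon S^1=\mathbf{R}/2\pi\mathbf{Z}\to\mathbf{R}^n$ parametrized by arclength, so that $|c'(t)|=1$ for almost every $t$. The integral is over $S^1$ (one period). The function $\lambda\colon\mathbf{R}\to\mathbf{R}$ is $\lambda(s)=2\sin\frac{s}{2}$; for $0\le s\le 2\pi$ it is the length of the chord connecting the end points of an arc of length $s$ in the unit circle. ''The unit circle'' means a round circle of radius $1$ in $\mathbf{R}^n$, parametrized at unit speed.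
   Formalization: If c(t+s)=c(t) for some t, the formal statement also assumes f(0) ≤ f(x) for x in (0,d(0,s)²]; otherwise f(0) is arbitrary and the claim fails (circle of radius 1/2 traversed twice, s=π). This is automatic if f is increasing on all of R. ''Increasing'' is strict. *)

(* Defs.v *)
From mathcomp Require Import all_boot all_order all_algebra.
From mathcomp Require Import all_classical all_reals all_analysis.

Set Implicit Arguments.
Unset Strict Implicit.
Unset Printing Implicit Defensive.

Import Order.TTheory GRing.Theory Num.Theory.
Import numFieldNormedType.Exports.

Local Open Scope classical_set_scope.
Local Open Scope ring_scope.

(* The library norm on 'rV[R]_n is the sup norm, hence an explicit Euclidean
   one. *)
Definition dot (R : realType) (n : nat) (u v : 'rV[R]_n) : R :=
  \sum_(i < n) u 0 i * v 0 i.

Definition enorm (R : realType) (n : nat) (u : 'rV[R]_n) : R :=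
  Num.sqrt (dot u u).

(* A map on S^1 = R / 2 pi Z is represented by a 2 pi-periodic map on R. *)

(* As for [variation], the vertices of the partition are a :: s, with last
   element b. *)
Definition polygon_length (R : realType) (n : nat) (c : R -> 'rV[R]_n)
    (a b : R) (s : seq R) : R :=
  let F := c \o nth b (a :: s) in
  \sum_(0 <= k < size s) enorm (F k.+1 - F k).

Definition curve_length (R : realType) (n : nat) (c : R -> 'rV[R]_n)
    (a b : R) : \bar R :=
  ereal_sup [set (polygon_length c a b s)%:E | s in itv_partition a b].

(* Parametrization by arclength; such a c is 1-Lipschitz and |c'| = 1 almost
   everywhere. *)
Definition unit_speed (R : realType) (n : nat) (c : R -> 'rV[R]_n) : Prop :=
  forall a b : R, a <= b -> curve_length c a b = (b - a)%:E.

(* The length over a period is 2 pi by unit_speed. *)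
Definition closed_unit_speed_curve (R : realType) (n : nat)
    (c : R -> 'rV[R]_n) : Prop :=
  periodic c (2 * pi) /\ unit_speed c.

(* Shortest distance along the curve between the points of parameters s and t:
   the infimum of the lengths of the arcs of c that run from s to some lift of
   t modulo 2 pi.  The points are identified by their parameters, so no
   shortcut is taken through a self-intersection. *)
Definition arc_dist (R : realType) (n : nat) (c : R -> 'rV[R]_n)
    (s t : R) : R :=
  fine (ereal_inf (range (fun k : int =>
    let t' := t + k%:~R * (2 * pi) in
    curve_length c (Num.min s t') (Num.max s t')))).

Definition chord (R : realType) (s : R) : R := 2 * sin (s / 2).

Definition concave_on (R : realType) (D : set R) (f : R -> R) : Prop :=
  convex_function D (fun x : R => - f x : R^o).

(* The orthonormal frame (u, v) spans the plane of the circle, and carries the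
   choice of base point and orientation. *)
Definition is_unit_circle (R : realType) (n : nat)
    (c : R -> 'rV[R]_n) : Prop :=
  exists p u v : 'rV[R]_n,
    [/\ dot u u = 1, dot v v = 1, dot u v = 0 &
        forall t : R, c t = p + cos t *: u + sin t *: v].

(* Main.v *)
Require Import Defs.
From mathcomp Require Import all_boot all_order all_algebra.
From mathcomp Require Import all_classical all_reals all_analysis.
From mathcomp Require Import measurable_realfun zify ring lra.

Import Order.TTheory GRing.Theory Num.Theory.
Import numFieldNormedType.Exports.

Local Open Scope classical_set_scope.
Local Open Scope ring_scope.

(* Let Phi(h) be the mean of |c(t+h) - c(t)|^2 and K the mean of |b|^2, where b
   is c minus its centre of mass.  Integrating the square of
   b(t+h) + b(t-h) - 2 cos h b(t) gives the doubling inequality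
     Phi(2h) <= 4 cos h Phi(h) + 4 (1 - cos h)^2 K,
   which is an equality for B(h) = K (2 - 2 cos h) + (1 - K) h sin h.  Since
   Phi(h) <= h^2 and B(h) = h^2 + O(h^4), iterating the doubling from h / 2^k
   gives Phi <= B on [0, pi].  By Fubini, Phi has integral 2 pi K over [0, pi],
   while B has integral 2 pi K + (1 - K) pi; hence K <= 1 and
   Phi(h) <= B(h) <= 2 - 2 cos h.  Equality at a single h forces K = 1, then
   Phi(h) = 2 - 2 cos h for all h, so that the integrated squares vanish and
   b(t) = cos t b(0) + sin t b(pi/2); the Lipschitz bound makes this frame
   orthonormal.  For a general f, integrate a supporting line of f at
   chord(s)^2, which lies in the interior of D. *)

(** * Continuity of composite expressions *)

Section continuity.
Context {R : realType}.
Implicit Types u v : R -> R.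

Lemma cont_cst (k : R) : continuous (fun _ : R => k).
Proof. by move=> x; exact: cvg_cst. Qed.

Lemma cont_id : continuous (fun x : R => x).
Proof. by move=> x; exact: cvg_id. Qed.

Lemma contD u v : continuous u -> continuous v ->
  continuous (fun x => u x + v x).
Proof. by move=> cu cv x; apply: continuousD; [exact: cu|exact: cv]. Qed.

Lemma contN u : continuous u -> continuous (fun x => - u x).
Proof. by move=> cu x; apply: continuousN; exact: cu. Qed.

Lemma contM u v : continuous u -> continuous v ->
  continuous (fun x => u x * v x).
Proof. by move=> cu cv x; apply: continuousM; [exact: cu|exact: cv]. Qed.

Lemma contX u n : continuous u -> continuous (fun x => u x ^+ n).
Proof.
move=> cu; elim: n => [|n ih]; first exact: cont_cst.
rewrite (_ : (fun x => _) = fun x => u x * u x ^+ n); first exact: contM.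
by apply/funext => x; rewrite exprS.
Qed.

Lemma cont_comp u v : continuous u -> continuous v ->
  continuous (fun x => u (v x)).
Proof. by move=> cu cv x; apply: continuous_comp; [exact: cv|exact: cu]. Qed.

Lemma cont_sum I (s : seq I) (u : I -> R -> R) :
  (forall i, continuous (u i)) -> continuous (fun x => \sum_(i <- s) u i x).
Proof.
move=> cu; elim: s => [|i s ih].
  rewrite (_ : (fun x => _) = fun=> 0); first exact: cont_cst.
  by apply/funext => x; rewrite big_nil.
rewrite (_ : (fun x => _) = fun x => u i x + \sum_(j <- s) u j x).
  exact: contD.
by apply/funext => x; rewrite big_cons.
Qed.

End continuity.

Ltac cont := match goal with
  | |- continuous (fun _ => ?k) => exact: cont_cst
  | |- continuous (fun x => x) => exact: cont_id
  | H : continuous ?u |- continuous ?u => exact: H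
  | H : (forall i, continuous (?u i)) |- continuous (?u _) => exact: H
  | |- continuous (fun x => cos (@?u x)) =>
     apply: (cont_comp _ u); [exact: continuous_cos|cont]
  | |- continuous (fun x => sin (@?u x)) =>
     apply: (cont_comp _ u); [exact: continuous_sin|cont]
  | |- continuous (fun x => \sum_(i <- _) (@?u i x)) =>
     apply: cont_sum => ?; cont
  | |- continuous (fun x => (@?u x) + (@?v x)) => apply: (contD u v); cont
  | |- continuous (fun x => - (@?u x)) => apply: (contN u); cont
  | |- continuous (fun x => (@?u x) * (@?v x)) => apply: (contM u v); cont
  | |- continuous (fun x => (@?u x) ^+ ?n) => apply: (contX u n); cont
  | H : continuous ?u |- continuous (fun x => ?u (@?v x)) =>
     apply: (cont_comp u v H); cont
  | H : (forall i, continuous (?u i)) |- continuous (fun x => ?u ?i (@?v x)) =>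
     apply: (cont_comp (u i) v (H i)); cont
  | H : (forall i, continuous _) |- continuous _ => exact: H
  end.

(** * Integrals of continuous functions: change of variable and positivity *)

Section integral.
Context {R : realType}.
Notation mu := (@lebesgue_measure R).
Implicit Types (u : R -> R) (a b : R).

Lemma continuous_integrable u a b : continuous u ->
  mu.-integrable `[a, b] (EFin \o u).
Proof.
move=> cu; apply: continuous_compact_integrable; first exact: segment_compact.
exact: continuous_subspaceT.
Qed.

Lemma Rintegral_cat u a b c : continuous u -> a <= b -> b <= c ->
  \int[mu]_(x in `[a, c]) u x =
  \int[mu]_(x in `[a, b]) u x + \int[mu]_(x in `[b, c]) u x.
Proof.
move=> cu ab bc.
have := @Rintegral_itvB R u (BLeft a) (BRight c) b
  (continuous_integrable _ _ _ cu).
rewrite !bnd_simp => /(_ ab bc) /eqP; rewrite subr_eq addrC => /eqP ->.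
congr (_ + _); apply: Rintegral_itv_obnd_cbnd.
apply: integrableS (continuous_integrable u b c cu) => //.
exact: subset_itv_oc_cc.
Qed.

Lemma Rintegral_reflect u a b h : continuous u -> a <= b ->
  \int[mu]_(x in `[h - b, h - a]) u x = \int[mu]_(x in `[a, b]) u (h - x).
Proof.
move=> cu ab; rewrite /Rintegral; congr fine.
pose F x := h - x.
have dF (x : R) : is_derive x (1 : R) F (-1).
  rewrite (_ : F = cst h - id)//; apply: is_derive_eq.
  by rewrite sub0r.
have F'E : derive1 F = cst (-1).
  by apply/funext => x; rewrite derive1E derive_val.
have cF : continuous F by rewrite /F; cont.
rewrite (@integration_by_substitution_decreasing R F u a b ab) ?F'E.
- by apply: eq_integral => x _ /=; rewrite mulrfctE /= opprK mulr1.
- by move=> x y _ _; rewrite /F ltrD2l ltrN2.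
- by move=> x _; exact: cvg_cst.
- exact: is_cvg_cst.
- exact: is_cvg_cst.
- split; first by move=> x _; exact: ex_derive.
  + by apply: cvg_at_right_filter; exact: cF.
  + by apply: cvg_at_left_filter; exact: cF.
- exact: continuous_subspaceT.
Qed.

(** A translation is the composite of two reflections, so the single substitution in
    [Rintegral_reflect] covers both. *)
Lemma Rintegral_translate u a b h : continuous u -> a <= b ->
  \int[mu]_(x in `[a + h, b + h]) u x = \int[mu]_(x in `[a, b]) u (x + h).
Proof.
move=> cu ab; have := @Rintegral_reflect u (- b) (- a) h cu.
rewrite !opprK lerN2 => /(_ ab); rewrite (addrC h) (addrC h) => ->.
have := @Rintegral_reflect (fun x => u (h - x)) a b 0.
rewrite !add0r => -> //; last by cont.
by apply: eq_Rintegral => x _; rewrite add0r opprK addrC.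
Qed.

(** Cut [h, T + h] at T and bring [T, T + h] back to [0, h] by periodicity. *)
Lemma Rintegral_shift u T h : continuous u -> periodic u T -> 0 <= h <= T ->
  \int[mu]_(x in `[0, T]) u (x + h) = \int[mu]_(x in `[0, T]) u x.
Proof.
move=> cu pu /andP[h0 hT]; have T0 := le_trans h0 hT.
rewrite -Rintegral_translate// add0r (@Rintegral_cat _ h T) ?lerDl//.
rewrite [RHS](@Rintegral_cat _ 0 h)// addrC; congr (_ + _).
rewrite -{1}(add0r T) (addrC T h) Rintegral_translate//.
by apply: eq_Rintegral => x _; rewrite pu.
Qed.

Lemma continuous_Rintegral_eq0 u a b : continuous u -> a < b ->
  {in `[a, b], forall x, 0 <= u x} -> \int[mu]_(x in `[a, b]) u x <= 0 ->
  {in `[a, b], forall x, u x = 0}.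
Proof.
move=> cu ab u0 iu x xab; apply/le_anti/andP; split; last exact: u0.
move: xab; rewrite in_itv/= => /andP[ax xb]; rewrite leNgt; apply/negP => ux.
have /cvgrPdist_lt /(_ (u x / 2)) := cu x; rewrite divr_gt0// => /(_ isT).
move=> /nbhs_ballP[e /= e0 xe].
(* On a nondegenerate segment [p, q] around [x] the function exceeds u(x) / 2. Half the radius keeps
   the closed segment inside the open ball; max and min cut it off at the ends of [a, b], where [x]
   may lie. *)
have [p [q [pq ap qb ep qe]]] : exists p q,
    [/\ p < q, a <= p, q <= b, x - e / 2 <= p & q <= x + e / 2].
  exists (Num.max a (x - e / 2)), (Num.min b (x + e / 2)).
  rewrite !le_max !ge_min !lexx ?orbT; split => //.
  by rewrite gt_max !lt_min ab; apply/andP; split; apply/andP; split; lra.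
have ge0 r1 r2 : a <= r1 -> r2 <= b -> 0 <= \int[mu]_(y in `[r1, r2]) u y.
  move=> ar rb; apply: Rintegral_ge0 => y /=; rewrite in_itv/= => /andP[ry yr].
  by apply: u0; rewrite in_itv/= (le_trans ar)// (le_trans yr).
move: iu; rewrite (@Rintegral_cat _ a p b)//; try lra.
rewrite (@Rintegral_cat _ p q b)//; try lra.
have I1 := ge0 a p (lexx _) ltac:(lra).
have I3 := ge0 q b ltac:(lra) (lexx _).
have I2 : u x / 2 * (q - p) <= \int[mu]_(y in `[p, q]) u y.
  rewrite [leLHS](_ : _ = \int[mu]_(y in `[p, q]) (u x / 2)).
    apply: le_Rintegral => //.
    - by apply: continuous_integrable; cont.
    - exact: continuous_integrable.
    - move=> y /=; rewrite in_itv/= => /andP[y1 y2].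
      have /xe /= : ball x e y.
        by rewrite /ball/= ltr_norml; apply/andP; split; lra.
      by rewrite ltr_norml => /andP[]; lra.
  rewrite Rintegral_cst//= lebesgue_measure_itv/= lte_fin.
  by rewrite ifT// -EFinD.
have I4 : 0 < u x / 2 * (q - p) by rewrite mulr_gt0 ?divr_gt0// subr_gt0.
have contra (i1 i2 i3 k : R) : i1 + (i2 + i3) <= 0 -> 0 <= i1 -> k <= i2 ->
  0 <= i3 -> 0 < k -> False by lra.
by move=> iu; exact: contra iu I1 I2 I3 I4.
Qed.
End integral.

(** * Elementary inequalities for sine and cosine *)

Section trigonometry.
Context {R : realType}.
Implicit Types x : R.

Lemma cos_half x : cos x = 1 - 2 * sin (x / 2) ^+ 2.
Proof.
rewrite {1}(_ : x = (x / 2) *+ 2); last by rewrite -mulr_natr; field.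
by rewrite cos_mulr2n cos2sin2; ring.
Qed.

Lemma sin_half x : sin x = 2 * sin (x / 2) * cos (x / 2).
Proof.
rewrite {1}(_ : x = (x / 2) *+ 2); last by rewrite -mulr_natr; field.
by rewrite sin_mulr2n; ring.
Qed.

(** For x < pi, the mean value theorem gives sin x = x cos c with cos c < 1; from pi on, sin x <= 1
    < 2 <= pi suffices. *)
Lemma sin_lt x : 0 < x -> sin x < x.
Proof.
move=> x0; have sin_small (y : R) : 0 < y -> y < pi -> sin y < y.
  move=> y0 ypi; have [//|c] := @MVT R sin cos 0 y y0.
  - by apply: continuous_subspaceT => ?; exact: continuous_sin.
  rewrite in_itv/= sin0 !subr0 => /andP[c0 cy] ->.
  rewrite gtr_pMl// -(@cos0 R) ltr_cos ?in_itv/= ?lexx ?pi_ge0//.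
  by rewrite (ltW c0) ltW// (lt_trans cy).
have [|pix] := ltP x pi; first exact: sin_small.
apply: (@le_lt_trans _ _ 1); first exact: sin_le1.
by apply: lt_le_trans pix; rewrite (lt_le_trans _ (pi_ge2 R)) // ltr1n.
Qed.

Lemma sin_le x : 0 <= x -> sin x <= x.
Proof.
by rewrite le_eqVlt => /predU1P[<-|/sin_lt/ltW//]; rewrite sin0.
Qed.

(** The difference sin y - y cos y vanishes at 0 and has derivative y sin y, positive on (0, pi). *)
Lemma mulr_cos_lt_sin x : 0 < x <= pi -> x * cos x < sin x.
Proof.
move=> /andP[x0 xpi].
pose f (y : R) := sin y - y * cos y; pose df (y : R) := y * sin y.
have dfE (y : R) : is_derive y (1 : R) f (df y).
  rewrite (_ : f = sin - id * cos)//; apply: is_derive_eq.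
  by rewrite /df /GRing.scale/=; ring.
have cf : continuous f by rewrite /f; cont.
have [c] := @MVT R f df 0 x x0 (fun y _ => dfE y) (continuous_subspaceT cf).
rewrite in_itv/= {1 2}/f sin0 !mul0r !subr0 => /andP[c0 cx] fx.
rewrite -subr_gt0 fx mulr_gt0// mulr_gt0// sin_gt0_pi// c0/=.
exact: lt_le_trans xpi.
Qed.

Lemma mulr_cos_le_sin x : 0 <= x <= pi -> x * cos x <= sin x.
Proof.
move=> /andP[]; rewrite le_eqVlt => /predU1P[<- _|x0 xpi].
  by rewrite mul0r sin0.
by apply/ltW/mulr_cos_lt_sin/andP.
Qed.

(** With y = x / 2, the difference of the two sides is 4 sin y (sin y - y cos y). *)
Lemma mulr_sin_lt x : 0 < x <= pi -> x * sin x < 2 - 2 * cos x.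
Proof.
move=> /andP[x0 xpi]; have y0 : 0 < x / 2 by rewrite divr_gt0.
have ypi : x / 2 < pi by lra.
have s0 : 0 < sin (x / 2) by rewrite sin_gt0_pi// y0.
have := @mulr_cos_lt_sin (x / 2); rewrite y0 ltW// -subr_gt0 => /(_ isT).
move=> /(mulr_gt0 s0); rewrite (sin_half x) (cos_half x); lra.
Qed.

(** The upper bound combines x cos x <= sin x with cos x >= 1 - x^2 / 2. An error of order four is
    what lets the iterated doubling converge. *)
Lemma sqr_sub_mulr_sin x : 0 <= x <= pi ->
  0 <= x ^+ 2 - x * sin x <= x ^+ 4 / 2.
Proof.
move=> /andP[x0 xpi]; apply/andP; split.
  by rewrite subr_ge0 expr2 ler_wpM2l// sin_le.
have s1 : sin (x / 2) ^+ 2 <= (x / 2) ^+ 2.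
  by rewrite ler_sqr ?nnegrE ?sin_le ?sin_ge0_pi//; lra.
have := @mulr_cos_le_sin x; rewrite x0 xpi cos_half => /(_ isT) s2.
have : x * (x * (1 - 2 * (x / 2) ^+ 2)) <= x * sin x.
  rewrite ler_wpM2l// (le_trans _ s2)// ler_wpM2l//; lra.
lra.
Qed.

(** With y = x / 2, the middle term is 4 (y^2 - sin^2 y), and y^2 cos^2 y <= sin^2 y bounds it by 4
    y^2 sin^2 y <= 4 y^4. *)
Lemma sqr_sub_chord x : 0 <= x <= pi ->
  0 <= x ^+ 2 - (2 - 2 * cos x) <= x ^+ 4 / 4.
Proof.
move=> /andP[x0 xpi]; have y0 : 0 <= x / 2 by lra.
have ypi : x / 2 <= pi by lra.
have s0 : 0 <= sin (x / 2) by rewrite sin_ge0_pi// y0.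
have c0 : 0 <= cos (x / 2) by rewrite cos_ge0_pihalf//; lra.
have s1 : sin (x / 2) ^+ 2 <= (x / 2) ^+ 2 by rewrite ler_sqr ?nnegrE ?sin_le.
have : (x / 2 * cos (x / 2)) ^+ 2 <= sin (x / 2) ^+ 2.
  by rewrite ler_sqr ?nnegrE ?mulr_ge0// mulr_cos_le_sin// y0.
have : (x / 2) ^+ 2 * sin (x / 2) ^+ 2 <= (x / 2) ^+ 2 * (x / 2) ^+ 2.
  by rewrite ler_wpM2l// sqr_ge0.
rewrite [(x / 2 * cos (x / 2)) ^+ 2]exprMn cos2sin2 (cos_half x); lra.
Qed.

End trigonometry.

(** * Comparison of Phi with B through the doubling inequality *)

Section doubling.
Context {R : realType}.
Notation mu := (@lebesgue_measure R).
Variables (Phi : R -> R) (K : R).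
Hypothesis cPhi : continuous Phi.
Hypothesis Phi_le : forall h : R, 0 <= h -> Phi h <= h ^+ 2.
Hypothesis K0 : 0 <= K.
Hypothesis Phi2 : forall h : R, 0 <= h <= pi / 2 ->
  Phi (2 * h) <= 4 * cos h * Phi h + 4 * (1 - cos h) ^+ 2 * K.
Hypothesis intPhi : \int[mu]_(h in `[0, pi]) Phi h = 2 * pi * K.

(** The first summand solves the doubling equation with its K term, and h sin h solves the
    homogeneous equation F(2h) = 4 cos h F(h). The coefficient 1 - K normalizes B(h) to h^2 at
    leading order. *)
Let B h := K * (2 - 2 * cos h) + (1 - K) * (h * sin h).

Let B2 h : B (2 * h) = 4 * cos h * B h + 4 * (1 - cos h) ^+ 2 * K.
Proof.
rewrite /B (cos_half (2 * h)) (sin_half (2 * h)) mulrAC divff// mul1r.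
by rewrite sin2cos2; ring.
Qed.

(** A doubling from h to 2h multiplies the gap Phi - B by at most 4 cos h <= 4, while halving the
    argument divides its fourth power by 16. Each iteration thus gains a factor 4 on a bound of
    order four. *)
Let Phi_B (h : R) : 0 <= h <= pi -> Phi h <= B h.
Proof.
have PhiB k : forall h : R, 0 <= h <= pi ->
    Phi h - B h <= (K + 1) * h ^+ 4 / 4 ^+ k.
  elim: k => [|k ih] {}h /andP[h0 hpi].
    have h0pi : 0 <= h <= pi by rewrite h0.
    have /andP[s1 s2] := sqr_sub_mulr_sin _ h0pi.
    have /andP[c1 c2] := sqr_sub_chord _ h0pi.
    (* The sign of 1 - K is not known yet: the gap is at most K (h^2 - (2 - 2 cos h)) + (h^2 - h sin
       h) - K (h^2 - h sin h), whose last term is nonpositive. *)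
    have := ler_wpM2l K0 c2; have := mulr_ge0 K0 s1; have := Phi_le _ h0.
    have : 0 <= h ^+ 4 by rewrite exprn_even_ge0.
    by move=> h4; have := mulr_ge0 K0 h4; rewrite /B expr0; lra.
  have h2 : 0 <= h / 2 <= pi / 2 by lra.
  have h2' : 0 <= h / 2 <= pi by lra.
  have cos0 : 0 <= cos (h / 2) by rewrite cos_ge0_pihalf//; lra.
  have := Phi2 _ h2; have := B2 (h / 2); rewrite mulrC divfK// => -> Phih.
  set X := (K + 1) * h ^+ 4 / 4 ^+ k.+1.
  have X0 : 0 <= X.
    by rewrite /X !mulr_ge0 ?addr_ge0 ?invr_ge0 ?exprn_ge0.
  have ihX : Phi (h / 2) - B (h / 2) <= X / 4.
    apply: le_trans (ih _ h2') _; rewrite le_eqVlt; apply/orP; left; apply/eqP.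
    by rewrite /X [4 ^+ k.+1]exprS; field; rewrite expf_neq0.
  have := ler_wpM2l cos0 ihX.
  have := ler_wpM2r X0 (cos_le1 (h / 2)).
  by lra.
move=> h0pi; rewrite leNgt; apply/negP; rewrite -subr_gt0 => D0.
set X := (K + 1) * h ^+ 4; have X0 : 0 <= X.
  by rewrite /X mulr_ge0 ?addr_ge0 ?exprn_even_ge0.
(* Some k has X / (Phi h - B h) < 2^k <= 4^k, against the bound [PhiB] for that k. *)
have := @upper_nthrootP R (X / (Phi h - B h)) _ (leqnn _).
set k := Num.bound _ => Xk; have := PhiB k h h0pi; rewrite -/X leNgt => /negP.
apply; rewrite ltr_pdivrMr ?exprn_gt0//.
move: Xk; rewrite ltr_pdivrMr// => /lt_le_trans; apply.
by rewrite mulrC (ler_wpM2l (ltW D0))// lerXn2r ?nnegrE ?ler_nat.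
Qed.

Let intB : \int[mu]_(h in `[0, pi]) B h = 2 * pi * K + (1 - K) * pi.
Proof.
pose F (h : R) := K * (2 * h - 2 * sin h) + (1 - K) * (sin h - h * cos h).
have cB : continuous B by rewrite /B; cont.
have cF : continuous F by rewrite /F; cont.
have dF (h : R) : is_derive h (1 : R) F (B h).
  rewrite (_ : F = (K \*: ((2 : R) \*: id - (2 : R) \*: sin) +
    (1 - K) \*: (sin - id * cos)))//.
  apply: is_derive_eq; rewrite /B /GRing.scale/=; ring.
rewrite /Rintegral (@continuous_FTC2 R B F) ?pi_gt0//=.
- by rewrite /F sinpi sin0 cospi; ring.
- exact: continuous_subspaceT.
- split; first by move=> x _; exact: ex_derive.
  + by apply: cvg_at_right_filter; exact: cF.
  + by apply: cvg_at_left_filter; exact: cF.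
- by move=> x _; rewrite derive1E derive_val.
Qed.

Let K_le1 : K <= 1.
Proof.
have : \int[mu]_(h in `[0, pi]) Phi h <= \int[mu]_(h in `[0, pi]) B h.
  apply: le_Rintegral => //; try exact: continuous_integrable.
    by apply: continuous_integrable; rewrite /B; cont.
rewrite intPhi intB lerDl pmulr_lge0 ?pi_gt0//; lra.
Qed.

Lemma doubling_le (h : R) : 0 <= h <= pi -> Phi h <= 2 - 2 * cos h.
Proof.
move=> h0pi; apply: le_trans (Phi_B _ h0pi) _; rewrite /B.
have : h * sin h <= 2 - 2 * cos h.
  case/andP: h0pi; rewrite le_eqVlt => /predU1P[<- _|h0 hpi].
    by rewrite mul0r cos0; lra.
  by apply/ltW/mulr_sin_lt; rewrite h0.
by rewrite -subr_ge0 => /(mulr_ge0 (_ : 0 <= 1 - K)); have := K_le1; lra.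
Qed.

(** If K < 1, then h sin h < 2 - 2 cos h makes B, hence Phi, strictly smaller than 2 - 2 cos h at
    [h0]. Once K = 1, Phi lies below 2 - 2 cos h with the same integral over [0, pi], so the two
    continuous functions agree there. *)
Lemma doubling_eq (h0 : R) : 0 < h0 <= pi -> Phi h0 = 2 - 2 * cos h0 ->
  K = 1 /\ forall h : R, 0 <= h <= pi -> Phi h = 2 - 2 * cos h.
Proof.
move=> h0pi Ph0; have K1 : K = 1.
  apply/le_anti; rewrite K_le1/= leNgt; apply/negP => K1.
  have := mulr_sin_lt _ h0pi; rewrite -subr_gt0.
  move=> /(mulr_gt0 (_ : 0 < 1 - K)) H.
  have := Phi_B h0 ltac:(lra); rewrite Ph0 /B; have := H ltac:(lra); lra.
split => // h hpi; apply/esym/eqP; rewrite -subr_eq0; apply/eqP.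
have intc : \int[mu]_(h in `[0, pi]) (2 - 2 * cos h) = 2 * pi * K.
  have := intB; rewrite K1 subrr mul0r addr0 => <-.
  by apply: eq_Rintegral => x _; rewrite /B K1; ring.
apply: (@continuous_Rintegral_eq0 R (fun h => 2 - 2 * cos h - Phi h) 0 pi).
- by cont.
- exact: pi_gt0.
- by move=> x; rewrite in_itv/= subr_ge0; exact: doubling_le.
- rewrite RintegralB// ?intPhi ?intc ?subrr//; last first.
    exact: continuous_integrable.
  by apply: continuous_integrable; cont.
- by rewrite in_itv/=.
Qed.

End doubling.

(** * Linearity and exchange of integrals *)

Section integral_continuous.
Context {R : realType}.
Notation mu := (@lebesgue_measure R).
Implicit Types (u v : R -> R) (a b k : R).

Lemma continuous_RintegralD u v a b : continuous u -> continuous v ->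
  \int[mu]_(x in `[a, b]) (u x + v x) =
  \int[mu]_(x in `[a, b]) u x + \int[mu]_(x in `[a, b]) v x.
Proof.
by move=> cu cv; apply: RintegralD => //; exact: continuous_integrable.
Qed.

Lemma continuous_RintegralZl u a b k : continuous u ->
  \int[mu]_(x in `[a, b]) (k * u x) = k * \int[mu]_(x in `[a, b]) u x.
Proof.
by move=> cu; apply: RintegralZl => //; exact: continuous_integrable.
Qed.

Lemma Rintegral_itv_cst a b k : a <= b ->
  \int[mu]_(x in `[a, b]) k = k * (b - a).
Proof.
move=> ab; rewrite Rintegral_cst//= lebesgue_measure_itv/= lte_fin.
case: ltP => [_|ba]; first by rewrite -EFinD.
by rewrite (_ : b = a) ?subrr//; apply/le_anti/andP.
Qed.

Lemma le_continuous_Rintegral u v a b : continuous u -> continuous v ->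
  {in `[a, b], forall x, u x <= v x} ->
  \int[mu]_(x in `[a, b]) u x <= \int[mu]_(x in `[a, b]) v x.
Proof.
move=> cu cv uv; apply: le_Rintegral => //; try exact: continuous_integrable.
Qed.

Lemma Rintegral_sum I (s : seq I) (u : I -> R -> R) a b :
  (forall i, continuous (u i)) ->
  \int[mu]_(x in `[a, b]) (\sum_(i <- s) u i x) =
  \sum_(i <- s) \int[mu]_(x in `[a, b]) u i x.
Proof.
move=> cu; elim: s => [|i s ih].
  under eq_Rintegral do rewrite big_nil.
  by rewrite big_nil Rintegral_cst// mul0r.
under eq_Rintegral do rewrite big_cons.
by rewrite big_cons continuous_RintegralD ?ih//; cont.
Qed.

Lemma Rintegral_shiftN u T h : continuous u -> periodic u T -> 0 <= h <= T ->
  \int[mu]_(x in `[0, T]) u (x - h) = \int[mu]_(x in `[0, T]) u x.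
Proof.
move=> cu pu hT.
rewrite -(@Rintegral_shift R (fun x => u (x - h)) T h)//; first last.
  by move=> x; rewrite -(pu (x - h)) addrAC.
  by cont.
by apply: eq_Rintegral => x _; rewrite addrK.
Qed.

(** Indicators move the square into the integrand, so that Tonelli applies on the whole plane.
    Continuity of the sections makes the inner integrals finite, so the real and extended ones
    agree. *)
Lemma exchange_Rintegral (G : R -> R -> R) (a b : R) :
  measurable_fun setT (fun z : R * R => G z.1 z.2) ->
  (forall x y, 0 <= G x y) ->
  (forall x, continuous (G x)) -> (forall y, continuous (G ^~ y)) ->
  \int[mu]_(x in `[a, b]) (\int[mu]_(y in `[a, b]) G x y) =
  \int[mu]_(y in `[a, b]) (\int[mu]_(x in `[a, b]) G x y).
Proof.
move=> mG G0 cG1 cG2; rewrite {1 3}/Rintegral; congr fine.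
pose A : set R := [set` `[a, b]].
pose F (z : R * R) : \bar R := (\1_A z.1 * (\1_A z.2 * G z.1 z.2))%:E.
have mA : measurable A by exact: measurable_itv.
have mF : measurable_fun setT
    (fun z : R * R => \1_A z.1 * (\1_A z.2 * G z.1 z.2)).
  apply: measurable_funM.
    exact: (measurableT_comp (measurable_indic mA) measurable_fst).
  apply: measurable_funM => //.
  exact: (measurableT_comp (measurable_indic mA) measurable_snd).
have F0 z : (0 <= F z)%E by rewrite lee_fin !mulr_ge0.
have sides (H : R -> R -> R) : (forall x, continuous (H x)) ->
    (\int[mu]_(x in A) (\int[mu]_(y in A) H x y)%:E =
     \int[mu]_x \int[mu]_y (\1_A x * (\1_A y * H x y))%:E)%E.
  move=> cH; rewrite integral_mkcond; apply: eq_integral => x _.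
  rewrite patchE; case: ifPn => xA; last first.
    rewrite integral0_eq// => y _.
    by rewrite indicE (negbTE xA) mul0r.
  rewrite fineK; last first.
    by apply: integrable_fin_num => //; exact: continuous_integrable.
  rewrite integral_mkcond; apply: eq_integral => y _.
  rewrite patchE !indicE xA mul1r; case: ifPn => yA; first by rewrite mul1r.
  by rewrite mul0r.
apply: etrans (sides G cG1) _; apply: esym.
apply: etrans (sides (fun y x => G x y) cG2) _; apply: esym.
have mF' : measurable_fun setT F by exact/measurable_EFinP.
apply: etrans (fubini_tonelli (m1 := mu) (m2 := mu) F mF' F0) _.
by apply: eq_integral => y _; apply: eq_integral => x _; rewrite /F/= mulrCA.
Qed.

End integral_continuous.

(** * Squared differences of one periodic coordinate *)

Section periodic_autocorrelation.
Context {R : realType}.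
Notation mu := (@lebesgue_measure R).
Variable b : R -> R.
Hypothesis b_lip : forall x y, `|b x - b y| <= `|x - y|.
Hypothesis b_per : periodic b (2 * pi).

(** For one coordinate [b], this and [sqr_norm] are the contributions to Phi(h) and K, before
    division by 2 pi. *)
Definition sqr_diff (h : R) : R :=
  \int[mu]_(t in `[0, 2 * pi]) (b (t + h) - b t) ^+ 2.
Definition sqr_norm : R := \int[mu]_(t in `[0, 2 * pi]) b t ^+ 2.

Let cb : continuous b.
Proof.
move=> x; apply/cvgrPdist_le => e e0; near=> y.
apply: le_trans (b_lip _ _) _; near: y.
by move: e e0; apply/cvgrPdist_le; exact: cvg_id.
Unshelve. all: by end_near. Qed.

(** Polarization turns every cross product into squared differences and squares. Each is a translate
    of a function whose integral over a period is already named, the difference b(t + h) - b(t - h)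
    having step 2h. *)
Lemma sqr_defect (h : R) : 0 <= h <= 2 * pi ->
  \int[mu]_(t in `[0, 2 * pi]) (b (t + h) + b (t - h) - 2 * cos h * b t) ^+ 2 =
  - sqr_diff (2 * h) + 4 * cos h * sqr_diff h + 4 * (1 - cos h) ^+ 2 * sqr_norm.
Proof.
move=> hpi; set c := cos h.
have -> : \int[mu]_(t in `[0, 2 * pi])
    (b (t + h) + b (t - h) - 2 * c * b t) ^+ 2 =
  \int[mu]_(t in `[0, 2 * pi]) ((-1) * (b (t - h + 2 * h) - b (t - h)) ^+ 2 +
    (2 * c * (b (t + h) - b t) ^+ 2 +
    (2 * c * (b (t - h + h) - b (t - h)) ^+ 2 +
    ((2 - 2 * c) * b (t + h) ^+ 2 + ((2 - 2 * c) * b (t - h) ^+ 2 +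
    (4 * c ^+ 2 - 4 * c) * b t ^+ 2))))).
  apply: eq_Rintegral => t _; rewrite subrK.
  by rewrite (_ : t - h + 2 * h = t + h); ring.
do 5 (rewrite continuous_RintegralD; [|cont|cont]).
do 6 (rewrite continuous_RintegralZl; [|cont]).
have per2 k : periodic (fun t => (b (t + k) - b t) ^+ 2) (2 * pi).
  by move=> t; rewrite addrAC !b_per.
have persq : periodic (fun t => b t ^+ 2) (2 * pi) by move=> t; rewrite b_per.
rewrite (@Rintegral_shiftN _ (fun t => (b (t + 2 * h) - b t) ^+ 2))//;
  last by cont.
rewrite (@Rintegral_shiftN _ (fun t => (b (t + h) - b t) ^+ 2))//; last by cont.
rewrite (@Rintegral_shiftN _ (fun t => b t ^+ 2))//; last by cont.
rewrite (@Rintegral_shift _ (fun t => b t ^+ 2))//; last by cont.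
by rewrite -/(sqr_diff _) -/(sqr_diff _) -/sqr_norm; ring.
Qed.

(** By periodicity a step of 2 pi - h is a step of - h, that is, the step h read backwards from its
    end point. *)
Lemma sqr_diff_reflect (h : R) : 0 <= h <= 2 * pi ->
  sqr_diff (2 * pi - h) = sqr_diff h.
Proof.
move=> hpi; rewrite /sqr_diff.
rewrite -[RHS](@Rintegral_shiftN _ (fun t => (b (t + h) - b t) ^+ 2) _ h)//.
- apply: eq_Rintegral => t _; rewrite subrK (addrC _ (- h)) addrA b_per; ring.
- by cont.
- by move=> t; rewrite addrAC !b_per.
Qed.

Lemma continuous_sqr_diff : continuous sqr_diff.
Proof.
move=> h; apply/cvgrPdist_le => e e0.
(* Factor the difference of squares: the difference of the two increments is at most |h - k|, their
   sum at most |h| + |k|. This majorant is continuous in [k] and vanishes at k = h. *)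
pose g (k : R) := 2 * pi * (`|h - k| * (`|h| + `|k|)).
have cg : continuous g.
  move=> k; rewrite /g; apply: cvgM; first exact: cvg_cst.
  apply: cvgM.
    by apply: cvg_norm; apply: cvgB; [exact: cvg_cst|exact: cvg_id].
  by apply: cvgD; [exact: cvg_cst|apply: cvg_norm; exact: cvg_id].
near=> k; apply: (@le_trans _ _ (g k)); last first.
  near: k; have /cvgrPdist_le /(_ e e0) := cg h.
  apply: filterS => k; rewrite {1}/g subrr normr0 mul0r mulr0.
  by rewrite sub0r normrN => /(le_trans (ler_norm _)).
rewrite /sqr_diff -RintegralB//; try by apply: continuous_integrable; cont.
apply: le_trans.
  by apply: le_normr_Rintegral => //; apply: continuous_integrable; cont.
have -> : g k = \int[mu]_(t in `[0, 2 * pi]) (`|h - k| * (`|h| + `|k|)).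
  by rewrite Rintegral_itv_cst ?mulr_ge0 ?pi_ge0// subr0 mulrC.
apply: le_Rintegral => //.
- apply: continuous_integrable => t; apply: cvg_norm.
  have : continuous (fun t => (b (t + h) - b t) ^+ 2 - (b (t + k) - b t) ^+ 2).
    by cont.
  exact.
- by apply: continuous_integrable; cont.
- move=> t _; rewrite subr_sqr normrM ler_pM//.
    rewrite (_ : b (t + h) - b t - _ = b (t + h) - b (t + k)); last by ring.
    by apply: le_trans (b_lip _ _) _; rewrite opprD addrACA subrr add0r.
  apply: le_trans (ler_normD _ _) _; rewrite lerD//.
    by apply: le_trans (b_lip _ _) _; rewrite addrAC subrr add0r.
  by apply: le_trans (b_lip _ _) _; rewrite addrAC subrr add0r.
Unshelve. all: by end_near. Qed.

Hypothesis b_mean : \int[mu]_(t in `[0, 2 * pi]) b t = 0.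

(** Over a full period of h, exchanging the integrals leaves the cross term proportional to the mean
    of [b], which is 0, and the two squares contribute equally. The symmetry of [sqr_diff_reflect]
    then gives half of the total to [0, pi]. *)
Lemma Rintegral_sqr_diff :
  \int[mu]_(h in `[0, pi]) sqr_diff h = 2 * pi * sqr_norm.
Proof.
have pi0 := pi_ge0 R.
have persq : periodic (fun t => b t ^+ 2) (2 * pi) by move=> t; rewrite b_per.
have full : \int[mu]_(h in `[0, 2 * pi]) sqr_diff h = 2 * (2 * pi * sqr_norm).
  rewrite /sqr_diff.
  rewrite (exchange_Rintegral (fun h t => (b (t + h) - b t) ^+ 2));
    last 4 first.
  - have mb := continuous_measurable_fun cb.
    apply: measurable_funX.
    apply: measurable_funB; apply: measurableT_comp => //.
    exact: measurable_funD.
  - by move=> x y; rewrite sqr_ge0.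
  - by move=> x; cont.
  - by move=> x; cont.
  transitivity (\int[mu]_(y in `[0, 2 * pi]) (sqr_norm + (2 * pi) * b y ^+ 2)).
    apply: eq_Rintegral => t; rewrite inE/= in_itv/= => t2pi.
    transitivity (\int[mu]_(h in `[0, 2 * pi])
        (b (h + t) ^+ 2 + ((- 2 * b t) * b (h + t) + b t ^+ 2))).
      by apply: eq_Rintegral => h _; rewrite (addrC t); ring.
    do 2 (rewrite continuous_RintegralD; [|cont|cont]).
    rewrite continuous_RintegralZl; last by cont.
    rewrite (@Rintegral_shift _ (fun t => b t ^+ 2))//; last by cont.
    rewrite (@Rintegral_shift _ b)// b_mean mulr0 add0r.
    rewrite Rintegral_itv_cst ?mulr_ge0//.
    by rewrite subr0 (mulrC (b t ^+ 2)).
  rewrite continuous_RintegralD; [|cont|cont].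
  rewrite continuous_RintegralZl; last by cont.
  rewrite Rintegral_itv_cst ?mulr_ge0// -/sqr_norm; ring.
move: full; rewrite (@Rintegral_cat _ _ 0 pi); first last.
- by rewrite ler_peMl// ler1n.
- by [].
- exact: continuous_sqr_diff.
have := @Rintegral_reflect _ sqr_diff 0 pi (2 * pi) continuous_sqr_diff pi0.
rewrite subr0 (_ : 2 * pi - pi = pi); last by ring.
have E : \int[mu]_(h in `[0, pi]) sqr_diff (2 * pi - h) =
         \int[mu]_(h in `[0, pi]) sqr_diff h.
  apply: eq_Rintegral => h; rewrite inE/= in_itv/= => /andP[h0 hpi].
  by rewrite sqr_diff_reflect// h0/=; lra.
move=> ->; rewrite E -mulr2n => EE; apply: (mulfI (_ : (2 : R) != 0)).
  by rewrite pnatr_eq0.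
by rewrite -EE mulr_natl.
Qed.

End periodic_autocorrelation.

(** * A functional equation characterizing sinusoids *)

Section sinusoid.
Context {R : realType}.
Implicit Types q b : R -> R.

(** Periodicity is asked of |q| so that antiperiodic functions are covered too. *)
Lemma normr_periodic_eq0 q (a T : R) : 0 < T ->
  (forall x, `|q (x + T)| = `|q x|) ->
  {in `[a, a + T], forall x, q x = 0} -> forall x, q x = 0.
Proof.
move=> T0 qT q0 x.
have qn (n : nat) y : `|q (y + n%:R * T)| = `|q y|.
  elim: n => [|n ih]; first by rewrite mul0r addr0.
  by rewrite -natr1 mulrDl mul1r addrA qT.
have qz (k : int) y : `|q (y + k%:~R * T)| = `|q y|.
  case: k => n; first exact: qn.
  by rewrite NegzE mulrNz mulNr -(qn n.+1 (y - _)) subrK.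
pose k := Num.floor ((x - a) / T).
have /andP[k1 k2] := floor_itv ((x - a) / T).
apply/eqP; rewrite -normr_eq0 -(subrK (k%:~R * T) x) qz normr_eq0 q0// in_itv/=.
move: k1 k2; rewrite ler_pdivlMr// ltr_pdivrMr// -/k intrD mulrDl mul1r.
by move=> k1 k2; apply/andP; split; lra.
Qed.

(** The step pi / 2 gives b(x + pi) = - b(x), so the window [- pi / 2, pi / 2] suffices. For y in
    [0, pi / 2], the equation at 0 with step y gives b(y) + b(-y), and the one at pi / 2 with step
    pi / 2 - y gives b(y) - b(-y). *)
Lemma sinusoid b :
  (forall t h, 0 <= h <= pi / 2 -> b (t + h) + b (t - h) = 2 * cos h * b t) ->
  forall t, b t = cos t * b 0 + sin t * b (pi / 2).
Proof.
move=> bE t; have pi0 := pi_ge0 R.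
have h2 : 0 <= (pi / 2 : R) <= pi / 2 by rewrite lexx divr_ge0.
have bpi x : b (x + pi) = - b x.
  have := bE (x + pi / 2) _ h2; rewrite addrK cos_pihalf mulr0 mul0r -addrA.
  by rewrite -splitr => /eqP; rewrite addr_eq0 => /eqP.
pose q x := b x - (cos x * b 0 + sin x * b (pi / 2)).
suff /(_ t)/eqP : forall x, q x = 0 by rewrite subr_eq0 => /eqP.
apply: (@normr_periodic_eq0 q (- (pi / 2)) pi (pi_gt0 R)) => [x|x].
  by rewrite /q bpi cosDpi sinDpi -(normrN (q x)) /q; congr `|_|; ring.
have q0 y : 0 <= y <= pi / 2 -> q y = 0 /\ q (- y) = 0.
  move=> /andP[y0 ypi]; have := bE 0 y.
  rewrite y0 ypi add0r sub0r => /(_ isT) b1.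
  have := bE (pi / 2) (pi / 2 - y).
  have -> : pi / 2 + (pi / 2 - y) = - y + pi :> R by lra.
  have -> : pi / 2 - (pi / 2 - y) = y :> R by lra.
  rewrite bpi cosB cos_pihalf sin_pihalf mul0r add0r mul1r => b2.
  have {}b2 := b2 ltac:(lra).
  rewrite /q cosN sinN; split; lra.
rewrite in_itv/= => /andP[x1 x2]; have [x0|x0] := leP 0 x.
  by have [] := q0 x; lra.
by have [_] := q0 (- x) ltac:(lra); rewrite opprK.
Qed.

End sinusoid.

(** * The Euclidean norm in coordinates *)

Section euclidean.
Context {R : realType} {n : nat}.
Implicit Types u v : 'rV[R]_n.

Lemma dot_ge0 u : 0 <= dot u u.
Proof. by apply: sumr_ge0 => i _; rewrite -expr2 sqr_ge0. Qed.

Lemma sqr_enorm u : enorm u ^+ 2 = dot u u.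
Proof. by rewrite sqr_sqrtr// dot_ge0. Qed.

Lemma sqr_enormE u : enorm u ^+ 2 = \sum_(i < n) u 0 i ^+ 2.
Proof. by rewrite sqr_enorm; apply: eq_bigr => i _; rewrite expr2. Qed.

Lemma enorm_ge0 u : 0 <= enorm u.
Proof. exact: sqrtr_ge0. Qed.

Lemma enormN u : enorm (- u) = enorm u.
Proof.
rewrite /enorm /dot; congr Num.sqrt.
by apply: eq_bigr => i _; rewrite !mxE mulrNN.
Qed.

Lemma normr_coord_le u i : `|u 0 i| <= enorm u.
Proof.
rewrite -(@ler_pXn2r _ 2)// ?nnegrE ?enorm_ge0//.
rewrite sqr_enormE real_normK ?num_real// (bigD1 i)//= lerDl.
by apply: sumr_ge0 => j _; rewrite sqr_ge0.
Qed.

Lemma dot_lincomb (a b : R) u v : dot (a *: u + b *: v) (a *: u + b *: v) =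
  a ^+ 2 * dot u u + 2 * a * b * dot u v + b ^+ 2 * dot v v.
Proof.
rewrite /dot !mulr_sumr -!big_split; apply: eq_bigr => i _ /=.
by rewrite !mxE; ring.
Qed.

End euclidean.

(** * Mean squared chords of closed unit-speed curves *)

Section curve.
Context {R : realType} {n : nat}.
Notation mu := (@lebesgue_measure R).
Variable c : R -> 'rV[R]_n.

(** The chord is an inscribed polygon with one edge. The case x = y is apart because partitions are
    strictly increasing. *)
Lemma unit_speed_lipschitz x y : unit_speed c -> enorm (c x - c y) <= `|x - y|.
Proof.
move=> uc; wlog xy : x y / y <= x => [W|].
  have [xy|/ltW xy] := leP y x; first exact: W.
  by rewrite -opprB enormN distrC; exact: W.
rewrite ger0_norm ?subr_ge0//; move: xy.
rewrite le_eqVlt => /predU1P[->|yx].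
  rewrite !subrr /enorm (_ : dot 0 0 = 0) ?sqrtr0//.
  by rewrite /dot big1// => i _; rewrite mxE mul0r.
rewrite -lee_fin -(uc y x (ltW yx)); apply: ereal_sup_ubound.
exists [:: x]; first exact: itv_partition1.
by rewrite /polygon_length /= big_nat1.
Qed.

(** Lifts with k >= 0 are at distance at least s from 0, those with k <= -1 at least 2 pi - s. This
    lower bound serves to place chord(s)^2 inside D and the squared chords of [c] below its right
    end. *)
Lemma arc_dist_ge s : unit_speed c -> 0 < s < 2 * pi ->
  Num.min s (2 * pi - s) <= arc_dist c 0 s.
Proof.
move=> uc /andP[s0 s2]; rewrite /arc_dist.
set A := (X in ereal_inf X).
have Alb : lbound A (Num.min s (2 * pi - s))%:E.
  move=> _ [k _ <-] /=.
  set t := s + _; rewrite uc; last by rewrite ge_min le_max lexx.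
  rewrite lee_fin ge_min.
  have [k0|k0] := leP 0 k.
    have : 0 <= k%:~R :> R by rewrite ler0z.
    move=> /mulr_ge0 /(_ (ltW (lt_trans s0 s2))) kpi.
    have t0 : 0 <= t by rewrite /t addr_ge0// ltW.
    by rewrite (min_idPl t0) (max_idPr t0) subr0 /t lerDl kpi.
  have : k%:~R <= -1 :> R by rewrite (_ : -1 = (-1)%:~R)// ler_int; lia.
  move=> /(ler_wpM2r (ltW (lt_trans s0 s2))) kpi.
  have t0 : t <= 0 by rewrite /t; lra.
  rewrite (min_idPr t0) (max_idPl t0) /t; apply/orP; right; lra.
(* The lift k = 0 bounds the infimum above, so it is finite and [fine] returns its true value. *)
have Aub : (ereal_inf A <= s%:E)%E.
  apply: ereal_inf_lbound; exists 0 => //.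
  rewrite mul0r addr0 (min_idPl (ltW s0)) (max_idPr (ltW s0)) uc ?ltW//.
  by rewrite subr0.
have {}Alb : ((Num.min s (2 * pi - s))%:E <= ereal_inf A)%E.
  exact: le_ereal_inf_tmp.
rewrite -lee_fin fineK// fin_numE; apply/andP; split.
  by rewrite -ltNye (lt_le_trans _ Alb)// ltNyr.
by rewrite -ltey (le_lt_trans Aub)// ltry.
Qed.

Hypothesis c_curve : closed_unit_speed_curve c.
Let c_per := c_curve.1.
Let c_lip x y := @unit_speed_lipschitz x y c_curve.2.

Definition coord_mean i : R :=
  (2 * pi)^-1 * \int[mu]_(t in `[0, 2 * pi]) c t 0 i.
Definition centered i (t : R) : R := c t 0 i - coord_mean i.
Let b := centered.

Let b_lip i x y : `|b i x - b i y| <= `|x - y|.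
Proof.
apply: le_trans (c_lip x y); apply: le_trans (normr_coord_le _ i).
by rewrite !mxE /b /centered opprB addrA subrK.
Qed.

Let b_per i : periodic (b i) (2 * pi).
Proof. by move=> t; rewrite /b /centered c_per. Qed.

Let cb i : continuous (b i).
Proof.
move=> x; apply/cvgrPdist_le => e e0; near=> y.
apply: le_trans (b_lip _ _ _) _; near: y.
by move: e e0; apply/cvgrPdist_le; exact: cvg_id.
Unshelve. all: by end_near. Qed.

Let cc i : continuous (fun t => c t 0 i).
Proof.
rewrite (_ : (fun t => _) = fun t => b i t + coord_mean i); first by cont.
by apply/funext => t; rewrite subrK.
Qed.

Let pi2_gt0 : 0 < 2 * pi :> R.
Proof. by rewrite mulr_gt0// pi_gt0. Qed.

Let b_mean i : \int[mu]_(t in `[0, 2 * pi]) b i t = 0.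
Proof.
rewrite /b /centered (@continuous_RintegralD _ _ (fun=> - coord_mean i));
  [|exact: cc|cont].
rewrite Rintegral_itv_cst ?ltW// /coord_mean subr0 mulNr mulrAC.
rewrite mulVf ?mul1r ?subrr//.
by rewrite gt_eqF.
Qed.

Definition mean_sqr_chord (h : R) : R :=
  (2 * pi)^-1 * \int[mu]_(t in `[0, 2 * pi]) enorm (c (t + h) - c t) ^+ 2.

Lemma continuous_sqr_chord h :
  continuous (fun t => enorm (c (t + h) - c t) ^+ 2).
Proof.
rewrite (_ : (fun t => _) = fun t => \sum_(i < n) (b i (t + h) - b i t) ^+ 2).
  by cont.
apply/funext => t; rewrite sqr_enormE; apply: eq_bigr => i _.
by rewrite !mxE /b /centered opprB addrA subrK.
Qed.

Let Phi := mean_sqr_chord.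
Let K : R := (2 * pi)^-1 * \sum_(i < n) sqr_norm (b i).

Let PhiE h : Phi h = (2 * pi)^-1 * \sum_(i < n) sqr_diff (b i) h.
Proof.
rewrite /Phi /mean_sqr_chord /sqr_diff -Rintegral_sum; last by move=> i; cont.
congr (_ * _); apply: eq_Rintegral => t _; rewrite sqr_enormE.
by apply: eq_bigr => i _; rewrite !mxE /b /centered opprB addrA subrK.
Qed.

Let cPhi : continuous Phi.
Proof.
rewrite (_ : Phi = fun h => (2 * pi)^-1 * \sum_(i < n) sqr_diff (b i) h).
  have csd i : continuous (sqr_diff (b i)) by exact: continuous_sqr_diff.
  by cont.
by apply/funext.
Qed.

Let Phi_le h : 0 <= h -> Phi h <= h ^+ 2.
Proof.
move=> h0; rewrite /Phi /mean_sqr_chord mulrC ler_pdivrMr//.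
have -> : h ^+ 2 * (2 * pi) = \int[mu]_(t in `[0, 2 * pi]) h ^+ 2.
  by rewrite Rintegral_itv_cst ?subr0 ?ltW.
apply: le_continuous_Rintegral.
- exact: continuous_sqr_chord.
- by cont.
- move=> t _; rewrite ler_sqr ?nnegrE ?enorm_ge0//.
  by apply: le_trans (c_lip _ _) _; rewrite addrAC subrr add0r ger0_norm.
Qed.

Let K_ge0 : 0 <= K.
Proof.
apply: mulr_ge0; first by rewrite invr_ge0 ltW.
apply: sumr_ge0 => i _.
by apply: Rintegral_ge0 => t _; rewrite sqr_ge0.
Qed.

Let sum_defect h : 0 <= h <= 2 * pi ->
  \sum_(i < n) \int[mu]_(t in `[0, 2 * pi])
     (b i (t + h) + b i (t - h) - 2 * cos h * b i t) ^+ 2 =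
  2 * pi * (- Phi (2 * h) + 4 * cos h * Phi h + 4 * (1 - cos h) ^+ 2 * K).
Proof.
move=> h2pi; under eq_bigr do rewrite sqr_defect//.
rewrite !big_split/= -!mulr_sumr sumrN !PhiE /K.
by have := lt0r_neq0 pi2_gt0; move: (2 * pi) => P P0; field.
Qed.

Let Phi2 h : 0 <= h <= pi / 2 ->
  Phi (2 * h) <= 4 * cos h * Phi h + 4 * (1 - cos h) ^+ 2 * K.
Proof.
move=> /andP[h0 hpi]; have := pi_gt0 R => pi0.
rewrite -subr_ge0 -(pmulr_rge0 _ pi2_gt0) addrC addrA -sum_defect; last by lra.
apply: sumr_ge0 => i _; apply: Rintegral_ge0 => t _; exact: sqr_ge0.
Qed.

Let intPhi : \int[mu]_(h in `[0, pi]) Phi h = 2 * pi * K.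
Proof.
have csd i : continuous (sqr_diff (b i)) by exact: continuous_sqr_diff.
under eq_Rintegral do rewrite PhiE.
rewrite continuous_RintegralZl; last by cont.
rewrite Rintegral_sum// /K; under eq_bigr do rewrite Rintegral_sqr_diff//.
by rewrite -mulr_sumr mulrCA.
Qed.

Let sqr_chordE (s : R) : chord s ^+ 2 = 2 - 2 * cos s.
Proof. by rewrite /chord (cos_half s); ring. Qed.

(** This symmetry, shared by the cosine, carries the results on [0, pi] over to all of (0, 2 pi). *)
Let Phi_reflect s : 0 <= s <= 2 * pi -> Phi (2 * pi - s) = Phi s.
Proof.
move=> s2pi; rewrite !PhiE; congr (_ * _); apply: eq_bigr => i _.
exact: sqr_diff_reflect.
Qed.

Let cos_reflect (s : R) : cos (2 * pi - s) = cos s.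
Proof. by rewrite -cosN opprB mulr_natl -[LHS]cosD2pi subrK. Qed.

Lemma mean_sqr_chord_le s : 0 < s < 2 * pi -> mean_sqr_chord s <= chord s ^+ 2.
Proof.
move=> /andP[s0 s2]; rewrite sqr_chordE.
have le h := @doubling_le R Phi K cPhi Phi_le K_ge0 Phi2 intPhi h.
have [spi|spi] := leP s pi; first by apply: le; rewrite ltW.
have s02 : 0 <= s <= 2 * pi by rewrite !ltW.
by rewrite -/Phi -(Phi_reflect s s02) -(cos_reflect s); apply: le; lra.
Qed.

Let K_eq s : 0 < s < 2 * pi -> mean_sqr_chord s = chord s ^+ 2 ->
  K = 1 /\ forall h : R, 0 <= h <= pi -> Phi h = 2 - 2 * cos h.
Proof.
move=> /andP[s0 s2]; rewrite sqr_chordE => Es.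
have Keq h := @doubling_eq R Phi K cPhi Phi_le K_ge0 Phi2 intPhi h.
have [spi|spi] := leP s pi; first by apply: (Keq s) => //; rewrite s0.
apply: (Keq (2 * pi - s)); first by apply/andP; split; lra.
by rewrite cos_reflect Phi_reflect// !ltW.
Qed.

(** Since h <= pi / 2, both Phi(h) and Phi(2h) are known, and with K = 1 the summed defect is 0.
    Each coordinate's squared defect then vanishes over a period, hence everywhere. *)
Let b_sinusoid s : 0 < s < 2 * pi -> mean_sqr_chord s = chord s ^+ 2 ->
  forall i t, b i t = cos t * b i 0 + sin t * b i (pi / 2).
Proof.
move=> s2 Es i; have [K1 PhiE'] := K_eq _ s2 Es; have pi0 := pi_gt0 R.
apply: sinusoid => t h h2; apply/eqP; rewrite -subr_eq0; apply/eqP.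
pose q i t := b i (t + h) + b i (t - h) - 2 * cos h * b i t.
have cq j : continuous (q j) by rewrite /q; cont.
apply: (@normr_periodic_eq0 _ (q i) 0 _ pi2_gt0) t => [t|t].
  by rewrite /q (addrAC t (2 * pi) h) (addrAC t (2 * pi) (- h)) !b_per.
rewrite add0r => t2; apply/eqP; rewrite -sqrf_eq0; apply/eqP.
apply: (@continuous_Rintegral_eq0 _ (fun t => q i t ^+ 2) 0 (2 * pi)) t2 => //.
- by cont.
- by move=> ? _; exact: sqr_ge0.
have /eqP : \sum_(j < n) \int[mu]_(t in `[0, 2 * pi]) q j t ^+ 2 = 0.
  rewrite sum_defect; last by lra.
  rewrite K1 !PhiE'; try lra.
  have h2E : 2 * h / 2 = h by field.
  by rewrite (cos_half (2 * h)) h2E sin2cos2; ring.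
rewrite psumr_eq0 => [/allP/(_ i)|j _]; last first.
  by apply: Rintegral_ge0 => ? _; exact: sqr_ge0.
by rewrite mem_index_enum => /(_ isT)/eqP ->.
Qed.

(** The Lipschitz bound limits the speed of the ellipse traced by [c] to 1, so |u|, |v| <= 1. The
    normalization K = 1 gives |u|^2 + |v|^2 = 2, hence both are unit vectors, and the speed bound at
    two diagonal parameters then gives u . v = 0. *)
Lemma mean_sqr_chord_eq s : 0 < s < 2 * pi ->
  mean_sqr_chord s = chord s ^+ 2 -> is_unit_circle c.
Proof.
move=> s2 Es; have bE := b_sinusoid _ s2 Es; have [K1 _] := K_eq _ s2 Es.
pose u := \row_(i < n) b i 0; pose v := \row_(i < n) b i (pi / 2).
have cE t : c t = \row_i coord_mean i + cos t *: u + sin t *: v.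
  apply/rowP => i; rewrite !mxE -addrA -bE /b /centered; ring.
have tangent t :
    dot (- sin t *: u + cos t *: v) (- sin t *: u + cos t *: v) <= 1.
  set w := _ + _; set N := dot w w; rewrite leNgt; apply/negP => N1.
  (* For this h < 1, cos^2 h N >= (1 - h) N = (N + 1) / 2 > 1, whereas the
     chord from t - h to t + h forces cos^2 h N <= 1. *)
  pose h := (N - 1) / (2 * N).
  have N0 : 0 < N by lra.
  have hN : h * N = (N - 1) / 2 by rewrite /h; field; exact: lt0r_neq0.
  have h0 : 0 < h by rewrite divr_gt0//; lra.
  have h1 : h < 1 by rewrite ltr_pdivrMr; lra.
  have hpi : h <= pi by have := pi_ge2 R; lra.
  clearbody h.
  have : enorm (c (t + h) - c (t - h)) ^+ 2 <= (2 * h) ^+ 2.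
    rewrite ler_sqr ?nnegrE ?enorm_ge0 ?mulr_ge0 ?(ltW h0)//.
    apply: le_trans (c_lip _ _) _.
    rewrite (_ : t + h - (t - h) = 2 * h); last by ring.
    by rewrite ger0_norm// mulr_ge0// ltW.
  (* The symmetric chord is exactly 2 sin h times the tangent vector [w]; the null summand gives the
     shape of [dot_lincomb]. *)
  have -> : enorm (c (t + h) - c (t - h)) = enorm ((2 * sin h) *: w + 0 *: w).
    congr enorm; apply/rowP => i.
    rewrite !cE !mxE !cosD !sinD cosN sinN; ring.
  rewrite sqr_enorm dot_lincomb -/N => H.
  have sN : sin h ^+ 2 * N <= h ^+ 2 by lra.
  have sc : (h * cos h) ^+ 2 <= sin h ^+ 2.
    have c0 : 0 <= cos h.
      by rewrite cos_ge0_pihalf//; have := pi_ge2 R; lra.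
    have hpi' : 0 <= h <= pi by rewrite ltW.
    by rewrite ler_sqr ?nnegrE ?mulr_ge0 ?(ltW h0) ?sin_ge0_pi ?mulr_cos_le_sin.
  have ss : sin h ^+ 2 <= h ^+ 2.
    by rewrite ler_sqr ?nnegrE ?sin_le ?sin_ge0_pi ?(ltW h0).
  have cN : cos h ^+ 2 * N <= 1.
    rewrite -(ler_pM2l (_ : 0 < h ^+ 2)) ?exprn_gt0// mulr1 mulrA -exprMn.
    by apply: le_trans sN; rewrite ler_wpM2r// ltW.
  have hh : h ^+ 2 <= h by rewrite expr2 ler_piMl// ltW.
  have : (1 - h) * N <= cos h ^+ 2 * N.
    by rewrite (ler_wpM2r (ltW N0))// cos2sin2; lra.
  lra.
have vv : dot v v <= 1.
  by have := tangent 0; rewrite dot_lincomb sin0 cos0; lra.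
have uu : dot u u <= 1.
  have := tangent (pi / 2); rewrite dot_lincomb sin_pihalf cos_pihalf; lra.
(* The sum |b(t)|^2 + |b(t + pi / 2)|^2 is constantly |u|^2 + |v|^2, and each of its terms has mean
   K = 1. *)
have uv : dot u u + dot v v = 2.
  have I1 : \int[mu]_(t in `[0, 2 * pi]) (\sum_(i < n) b i t ^+ 2) = 2 * pi.
    rewrite Rintegral_sum => [|i]; last by cont.
    transitivity (2 * pi * K); last by rewrite K1 mulr1.
    by rewrite /K mulVKf// gt_eqF.
  have I2 : \int[mu]_(t in `[0, 2 * pi])
      (\sum_(i < n) b i (t + pi / 2) ^+ 2) = 2 * pi.
    rewrite (@Rintegral_shift _ (fun t => \sum_(i < n) b i t ^+ 2))//.
    - by cont.
    - by move=> t; apply: eq_bigr => i _; rewrite b_per.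
    - by have := pi_gt0 R; lra.
  have : \int[mu]_(t in `[0, 2 * pi])
      (\sum_(i < n) b i t ^+ 2 + \sum_(i < n) b i (t + pi / 2) ^+ 2) =
      (dot u u + dot v v) * (2 * pi - 0).
    rewrite -Rintegral_itv_cst ?ltW//; apply: eq_Rintegral => t _.
    rewrite -!big_split; apply: eq_bigr => i _ /=.
    rewrite !mxE (bE i t) (bE i (t + pi / 2)) cosDpihalf sinDpihalf.
    by have := cos2Dsin2 t; set x := cos t; set y := sin t; nra.
  rewrite continuous_RintegralD; [|cont|cont].
  rewrite I1 I2 subr0 => H; apply: (mulIf (lt0r_neq0 pi2_gt0)).
  by rewrite -H; ring.
have u1 : dot u u = 1 by lra.
have v1 : dot v v = 1 by lra.
(* The squared speed is now 1 - 2 sin t cos t (u . v); t = pi / 4 and t = - pi / 4 give opposite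
   signs. *)
have sc (t : R) : - 2 * sin t * cos t * dot u v <= 0.
  have := tangent t; rewrite dot_lincomb u1 v1 sqrrN !mulr1.
  by have := cos2Dsin2 t; lra.
have sc4 : 2 * sin (pi / 4) * cos (pi / 4) = 1 :> R.
  rewrite -[RHS]sin_pihalf (sin_half (pi / 2)).
  by rewrite (_ : pi / 2 / 2 = pi / 4)//; lra.
exists (\row_i coord_mean i), u, v; split => //.
have := sc (pi / 4); have := sc (- (pi / 4)); rewrite sinN cosN.
have -> : - 2 * - sin (pi / 4) * cos (pi / 4) * dot u v = dot u v :> R.
  by rewrite -[RHS]mul1r -[X in _ = X * _]sc4; ring.
have -> : - 2 * sin (pi / 4) * cos (pi / 4) * dot u v = - dot u v :> R.
  by rewrite -[RHS]mul1r -[X in _ = X * _]sc4; ring.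
lra.
Qed.

Lemma unit_circle_sqr_chord s t : is_unit_circle c ->
  enorm (c (t + s) - c t) ^+ 2 = chord s ^+ 2.
Proof.
move=> [p [u [v [uu vv uv cE]]]].
have -> : c (t + s) - c t =
    (cos (t + s) - cos t) *: u + (sin (t + s) - sin t) *: v.
  by rewrite !cE; apply/rowP => i; rewrite !mxE; ring.
rewrite sqr_enorm dot_lincomb uu vv uv sqr_chordE cosD sinD.
have := cos2Dsin2 t; have := cos2Dsin2 s.
move: (cos s) (sin s) (cos t) (sin t) => x y z w h1 h2.
transitivity ((z ^+ 2 + w ^+ 2) * (x ^+ 2 + y ^+ 2 + 1 - 2 * x)); first by ring.
by rewrite h1 h2; ring.
Qed.

End curve.

(** * Increasing concave functions: supporting lines and integrability *)

Section concave.
Context {R : realType}.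
Notation mu := (@lebesgue_measure R).
Implicit Types (f g : R -> R) (m M L : R).

(** Concavity with weight (z - y) / (z - x), multiplied through by z - x so that slopes compare by
    linear arithmetic. *)
Lemma concave_on_chord (D : set R) f x y z : concave_on D f ->
  x \in D -> z \in D -> x < y < z ->
  (z - y) * f x + (y - x) * f z <= (z - x) * f y.
Proof.
move=> cf xD zD /andP[xy yz]; have xz : 0 < z - x by lra.
have t0 : 0 <= (z - y) / (z - x) by rewrite divr_ge0//; lra.
have t1 : (z - y) / (z - x) <= 1 by rewrite ler_pdivrMr//; lra.
have := cf (Itv01 t0 t1) x z xD zD; rewrite !convRE /= /unstable.onem.
set t := (z - y) / (z - x).
have tE : t * (z - x) = z - y by rewrite /t divfK// gt_eqF.
set w : R := (X in - f X).
have -> : w = y by transitivity (t * x + (1 - t) * z); [by []|lra].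
move=> /(ler_wpM2r (ltW xz)).
have -> : (t * - f x + (1 - t) * - f z) * (z - x) =
   - (t * (z - x) * f x + ((z - x) - t * (z - x)) * f z) by ring.
rewrite tE; lra.
Qed.

(** The slope is the supremum of the slopes of chords to the right of L. By concavity every chord to
    the left is at least as steep, so the line dominates on both sides; the chord to M > L makes the
    slope positive. *)
Lemma concave_supporting_line m M f L : m < L < M ->
  {in `]m, M] &, increasing_fun f} -> concave_on `]m, M]%classic f ->
  exists2 k, 0 < k & {in `]m, M], forall x, f x <= f L + k * (x - L)}.
Proof.
move=> /andP[mL LM] fi fc.
have LD : L \in `]m, M] by rewrite in_itv/= mL ltW.
have MD : M \in `]m, M] by rewrite in_itv/= lexx (lt_trans mL).
pose S := [set (f y - f L) / (y - L) | y in `]L, M]].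
have Sub x : m < x < L -> ubound S ((f L - f x) / (L - x)).
  move=> /andP[mx xL] _ [y /= + <-]; rewrite in_itv/= => /andP[Ly yM].
  rewrite ler_pdivrMr ?subr_gt0// mulrAC ler_pdivlMr ?subr_gt0//.
  have := @concave_on_chord _ f x L y fc; rewrite !inE/= !in_itv/=.
  rewrite mx Ly xL yM (lt_trans mL Ly) (ltW (lt_le_trans xL (ltW LM))).
  by move=> /(_ isT isT isT); lra.
have SM : S ((f M - f L) / (M - L)).
  by exists M => //=; rewrite in_itv/= LM lexx.
have hsS : has_sup S.
  split; first by eexists; exact: SM.
  by exists ((f L - f ((m + L) / 2)) / (L - (m + L) / 2)); apply: Sub; lra.
exists (sup S).
  apply: lt_le_trans (ub_le_sup hsS.2 SM); rewrite divr_gt0 ?subr_gt0//.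
  by rewrite ltNge fi// -ltNge.
move=> x; rewrite in_itv/= => /andP[mx xM].
have [xL|Lx|->] := ltgtP x L; last by rewrite subrr mulr0 addr0.
  have : sup S <= (f L - f x) / (L - x).
    apply: ge_sup; first by eexists; exact: SM.
    by apply: Sub; rewrite mx.
  by rewrite ler_pdivlMr ?subr_gt0//; lra.
have : (f x - f L) / (x - L) <= sup S.
  by apply: (ub_le_sup hsS.2); exists x => //=; rewrite in_itv/= Lx.
by rewrite ler_pdivrMr ?subr_gt0//; lra.
Qed.

(** Precomposing [f] with the clamp onto [m, M] gives a function monotone on the whole line, hence
    measurable, without changing the values along [g]; these lie between f(m) and f(M). *)
Lemma monotone_comp_integrable f g m M (a b : R) : continuous g ->
  {in `[a, b], forall t, m <= g t <= M} ->
  {in `[m, M] &, {homo f : x y / x <= y}} ->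
  mu.-integrable `[a, b] (EFin \o (fun t => f (g t))).
Proof.
move=> cg gmM fi; have [ba|ab] := ltP b a.
  by rewrite set_itv_ge ?bnd_simp -?ltNge//; exact: integrable_set0.
have mM : m <= M.
  have /andP[] := gmM a ltac:(by rewrite in_itv/= lexx ab).
  exact: le_trans.
pose cl x := Num.max m (Num.min x M).
have clmM x : cl x \in `[m, M].
  by rewrite in_itv/= le_max lexx/= ge_max mM ge_min lexx orbT.
pose F x := f (cl x).
have Fnd : {homo F : x y / x <= y}.
  move=> x y xy; apply: fi => //; rewrite /cl ge_max le_max lexx/= le_max.
  by apply/orP; right; rewrite le_min !ge_min xy lexx orbT.
have FE t : t \in `[a, b] -> F (g t) = f (g t).
  by move=> /gmM /andP[h1 h2]; rewrite /F /cl (min_idPl h2) (max_idPr h1).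
suff : mu.-integrable `[a, b] (EFin \o (fun t => F (g t))).
  by apply: eq_integrable => // t; rewrite inE/= => /FE ->.
apply: measurable_bounded_integrable => //.
- rewrite /= lebesgue_measure_itv/=.
  by case: ifP => _; rewrite ?ltry// -EFinD ltry.
- apply: (measurableT_comp (nondecreasing_measurable measurableT Fnd)).
  apply: measurable_funS (continuous_measurable_fun cg) => //.
- exists (`|f m| + `|f M|); split; first exact: num_real.
  move=> z zM t /= tab; rewrite FE//.
  have mD : m \in `[m, M] by rewrite in_itv/= lexx.
  have MD : M \in `[m, M] by rewrite in_itv/= lexx mM.
  have gD : g t \in `[m, M] by rewrite in_itv/=; exact: gmM.
  have /andP[g1 g2] := gmM t tab.
  have := fi _ _ mD gD g1; have := fi _ _ gD MD g2.
  have := ler_norm (f M); have := ler_norm (- f m); rewrite normrN.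
  have := normr_ge0 (f M); have := normr_ge0 (f m).
  by move=> *; rewrite ler_norml; apply/andP; split; lra.
Qed.

End concave.

(* [f0] only restricts f when the integrand involves the value f 0, i.e. when
   c identifies two points at parameter distance s; it holds for every f that
   is increasing on the whole line. *)
Theorem theorem3p1 (R : realType) (n : nat) (c : R -> 'rV[R]_n) (s : R)
    (f : R -> R) (D := `]0, arc_dist c 0 s ^+ 2]%classic : set R)
    (c_curve : closed_unit_speed_curve c)
    (s_gt0 : 0 < s) (s_lt2pi : s < 2 * pi)
    (f_incr : {in D &, increasing_fun f})
    (f_concave : concave_on D f)
    (f0 : (exists t : R, c (t + s) = c t) -> {in D, forall x, f 0 <= f x}) :
  let mean := (2 * pi)^-1 *
    \int[lebesgue_measure]_(t in `[0, 2 * pi])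
      f (enorm (c (t + s) - c t) ^+ 2) in
  mean <= f (chord s ^+ 2) /\
  (mean = f (chord s ^+ 2) <-> is_unit_circle c).
Proof.
move=> mean; have pi2 : 0 < 2 * pi :> R by rewrite mulr_gt0// pi_gt0.
have s2 : 0 < s < 2 * pi by rewrite s_gt0.
pose g t := enorm (c (t + s) - c t) ^+ 2.
have cg : continuous g by exact: continuous_sqr_chord.
pose d := arc_dist c 0 s.
have dmin : Num.min s (2 * pi - s) <= d := arc_dist_ge c s c_curve.2 s2.
pose L := chord s ^+ 2; pose M := d ^+ 2.
have min0 : 0 < Num.min s (2 * pi - s) by rewrite lt_min s_gt0 subr_gt0.
have chord0 : 0 < chord s by rewrite mulr_gt0// sin_gt0_pi; lra.
(* Apply sin x < x at s / 2 and at pi - s / 2, which have the same sine. *)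
have chord_lt : chord s < Num.min s (2 * pi - s).
  have chord1 (x : R) : 0 < x -> chord x < x.
    by move=> x0; have := @sin_lt R (x / 2) ltac:(lra); rewrite /chord; lra.
  rewrite lt_min chord1//=; have := chord1 (2 * pi - s) ltac:(lra).
  rewrite /chord (_ : (2 * pi - s) / 2 = pi - s / 2); last by lra.
  by rewrite sinB sinpi cospi mul0r sub0r mulN1r opprK.
have L0M : 0 < L < M.
  rewrite exprn_gt0//= ltr_sqr ?nnegrE ?(ltW chord0) ?(lt_le_trans chord_lt)//.
  exact: ltW (lt_le_trans min0 dmin).
have inD x : (x \in D) = (0 < x <= M) by rewrite /D mem_setE in_itv.
have LD : L \in D by rewrite inD; case/andP: L0M => -> /ltW ->.
have gM t : 0 <= g t <= M.
  rewrite sqr_ge0/= ler_sqr ?nnegrE ?enorm_ge0 ?(ltW (lt_le_trans min0 dmin))//.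
  apply: le_trans dmin; rewrite le_min.
  have lip x y := unit_speed_lipschitz c x y c_curve.2.
  apply/andP; split.
    by apply: le_trans (lip _ _) _; rewrite addrAC subrr add0r gtr0_norm.
  (* The bound 2 pi - s comes from going forward from t + s to t + 2 pi, where [c] has the value
     c(t) again. *)
  rewrite -(c_curve.1 t); apply: le_trans (lip _ _) _.
  by rewrite distrC gtr0_norm; lra.
have f_incr' : {in `]0, M] &, increasing_fun f}.
  by move=> x y; rewrite !in_itv/= => xD yD; apply: f_incr; rewrite inD.
have [k k0 fk] := @concave_supporting_line _ 0 M f L L0M f_incr' f_concave.
(* As 0 is outside D, the supporting line is extended to 0 by a limit: f(0) <= f(x) <= f(L) + k (x -
   L) for small x > 0. The chosen x makes k x at most half of the supposed excess [e]. *)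
have f0' : (exists t : R, c (t + s) = c t) -> f 0 <= f L + k * (0 - L).
  move=> /f0 f0x; rewrite leNgt; apply/negP => f0L.
  pose e := f 0 - (f L + k * (0 - L)); have e0 : 0 < e by rewrite subr_gt0.
  pose x := Num.min L (e / (2 * k)).
  have x0 : 0 < x by rewrite lt_min (andP L0M).1 divr_gt0// mulr_gt0.
  have xL : x <= L by rewrite ge_min lexx.
  have xM : x <= M by apply: le_trans xL _; case/andP: L0M => _ /ltW.
  have xk : x * k <= e / 2.
    by rewrite -ler_pdivlMr// /x ge_min -mulrA -invfM lexx orbT.
  have xD : x \in D by rewrite inD x0.
  have := fk x; rewrite in_itv/= x0 xM => /(_ isT); have := f0x _ xD.
  rewrite /e in e0 xk; lra.
have g0 t : g t = 0 -> c (t + s) = c t.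
  rewrite /g sqr_enormE => /eqP.
  rewrite psumr_eq0 => [/allP gi|i _]; last exact: sqr_ge0.
  apply/rowP => i; have := gi i; rewrite mem_index_enum sqrf_eq0 !mxE subr_eq0.
  by move=> /(_ isT)/eqP.
have fgk t : f (g t) <= f L + k * (g t - L).
  have /andP[] := gM t; rewrite le_eqVlt => /predU1P[gt0 _|gt0 gtM].
    by rewrite -gt0; apply: f0'; exists t; apply: g0.
  by apply: fk; rewrite in_itv/= gt0.
have ifg : lebesgue_measure.-integrable `[0, 2 * pi]
    (EFin \o (fun t => f (g t))).
  (* If some chord vanishes, [f0] makes f monotone on [0, M]. Otherwise the minimum of [g] over a
     period is positive, and f is monotone from there to M. *)
  have [cross|ncross] := pselect (exists t : R, c (t + s) = c t).
    apply: (@monotone_comp_integrable _ f g 0 M) => // x y.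
    rewrite !in_itv/= => /andP[x0 xM] /andP[y0 yM] xy.
    move: x0 xy; rewrite le_eqVlt => /predU1P[<-|x0 xy].
      move: y0; rewrite le_eqVlt => /predU1P[<- //|y0 _].
      by apply: f0 => //; rewrite inD y0.
    by rewrite f_incr' ?in_itv/= ?x0// (lt_le_trans x0 xy).
  have [|t0 _ gt0] := @EVT_min R g 0 (2 * pi) (ltW pi2).
    exact: continuous_subspaceT.
  have gt00 : 0 < g t0.
    have /andP[+ _] := gM t0; rewrite le_eqVlt => /predU1P[/esym/g0 ct|//].
    by case: ncross; exists t0.
  apply: (@monotone_comp_integrable _ f g (g t0) M) => // [t tI|x y].
    by rewrite gt0//; have /andP[] := gM t.
  rewrite !in_itv/= => /andP[x0 xM] /andP[y0 yM] xy.
  by rewrite f_incr' ?in_itv/= ?xM ?yM ?(lt_le_trans gt00).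
have mean_le : mean <= f L + k * (mean_sqr_chord c s - L).
  have -> : f L + k * (mean_sqr_chord c s - L) = (2 * pi)^-1 *
      \int[lebesgue_measure]_(t in `[0, 2 * pi]) ((f L - k * L) + k * g t).
    rewrite (@continuous_RintegralD _ (fun=> f L - k * L)); [|cont|cont].
    rewrite continuous_RintegralZl// Rintegral_itv_cst ?ltW// subr0.
    rewrite /mean_sqr_chord.
    have := mulVf (lt0r_neq0 pi2); move: (2 * pi) (2 * pi)^-1 (Rintegral _ _ _).
    move=> p q I qp.
    transitivity ((f L - k * L) * (q * p) + k * (q * I)); last by ring.
    by rewrite qp; ring.
  rewrite ler_pM2l ?invr_gt0//; apply: le_Rintegral => //.
    by apply: continuous_integrable; cont.
  by move=> t _; have := fgk t; lra.
have Phi_le : mean_sqr_chord c s <= L := mean_sqr_chord_le c c_curve s s2.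
split.
  apply: le_trans mean_le _; rewrite gerDl pmulr_rle0//; lra.
split=> [E|circ].
  (* Equality makes k (mean squared chord - L) nonnegative, and k > 0 yields the missing
     inequality. *)
  apply: (mean_sqr_chord_eq c c_curve s s2); apply/le_anti; rewrite Phi_le/=.
  by move: mean_le; rewrite E lerDl pmulr_rge0// subr_ge0.
rewrite /mean (_ : \int[_]_(t in _) _ = f L * (2 * pi)).
  by rewrite mulrC mulfK// gt_eqF.
transitivity (\int[lebesgue_measure]_(t in `[0, 2 * pi]) f L).
  by apply: eq_Rintegral => t _; rewrite unit_circle_sqr_chord.
by rewrite Rintegral_itv_cst ?subr0 ?ltW.
Qed.
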